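(* Let $k\geq 4$ be an even integer and let $q$ denote the smallest prime power for which $k\leq q$. Then $$n(k,7)\leq 2kq^2-q.$$ In particular, if $q$ is odd, then $$n(q-1,7)\leq 2q^3-2q^2-q=2(q-1)^3+4(q-1)^2+(q-1)-1.$$
   Context: Graphs are finite and simple. The girth of a graph is the length of its shortest cycle. A $(k,g)$-graph is a $k$-regular graph with girth (exactly) $g$. For $k\ge 2$ and $g\ge 3$, $n(k,g)$ denotes the minimum number of vertices of a $(k,g)$-graph (such graphs exist for all $k\geq 2$, $g\geq 3$ by a theorem of Erdős and Sachs). *)

(* Defs.v *)
From mathcomp Require Import all_boot.

Set Implicit Arguments.
Unset Strict Implicit.
Unset Printing Implicit Defensive.

Definition simple_graph (V : finType) (e : rel V) : Prop :=
  symmetric e /\ irreflexive e.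

Definition regular (V : finType) (e : rel V) (k : nat) : Prop :=
  forall x : V, #|[set y | e x y]| = k.

(* [ucycle e] also accepts the empty sequence and, for a symmetric e, the walk
   x, y, x along a single edge; the size condition excludes both. *)
Definition graph_cycle (V : finType) (e : rel V) (c : seq V) : Prop :=
  2 < size c /\ ucycle e c.

(* A forest has no girth in this sense. *)
Definition has_girth (V : finType) (e : rel V) (g : nat) : Prop :=
  (exists2 c : seq V, graph_cycle e c & size c = g) /\
  (forall c : seq V, graph_cycle e c -> g <= size c).

Definition kg_graph (k g : nat) (V : finType) (e : rel V) : Prop :=
  [/\ simple_graph e, regular e k & has_girth e g].

(* The graph of the partial function (k, g) |-> n(k, g): since n(k, g) is a
   minimum, [is_kg_order k g n] also asserts that some (k, g)-graph exists. *)
Definition is_kg_order (k g n : nat) : Prop :=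
  (exists (V : finType) (e : rel V), kg_graph k g e /\ #|V| = n) /\
  (forall (V : finType) (e : rel V), kg_graph k g e -> n <= #|V|).

Lemma is_kg_order_unique k g n n' :
  is_kg_order k g n -> is_kg_order k g n' -> n = n'.
Proof.
move=> [[V [e [eP <-]]] minV] [[W [f [fP <-]]] minW].
by apply/eqP; rewrite eqn_leq (minV W f) // (minW V e).
Qed.

Definition prime_power (q : nat) : Prop :=
  exists p m : nat, [/\ prime p, 0 < m & q = p ^ m].

Definition smallest_prime_power_geq (k q : nat) : Prop :=
  [/\ prime_power q, k <= q &
      forall r : nat, prime_power r -> k <= r -> q <= r].

(* Main.v *)
(* Over the field F with q elements, let the point (a, b, c) be incident with
   the line [x, y, z] when y = a x - b and z = a y - c: this incidence graph has
   girth 8.  Restricting a and x to a k-subset A of F containing 0 makes it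
   k-regular on 2 k q^2 vertices.  Removing the q points (0, 0, c) costs one
   neighbour to each line [x, 0, z]; since k is even, A has a fixed-point-free
   involution f, and joining [x, 0, z] to [f x, 0, z] restores k-regularity.
   The ends of an added edge shared a removed neighbour, so they are now at
   distance at least 6, and lines [x, 0, z] with distinct z are at distance at
   least 4: the girth stays at least 7.  A 7-cycle through [0, 0, 0] and
   [1, 0, 0] exists as soon as 0, 1, 2 are in A and f 0 = 1. *)
Require Import Defs.
From mathcomp Require Import all_boot.
From mathcomp Require Import all_algebra all_field ring zify.
From Stdlib Require Import Classical.

Set Implicit Arguments.
Unset Strict Implicit.
Unset Printing Implicit Defensive.

Import GRing.Theory.

(** * Minimum order, involutions and restriction to a vertex set *)

(** Descent on the number of vertices, excluded middle deciding whether a smaller graph exists. One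
    explicit graph thus yields both the existence of the minimum and the bound. *)
Lemma kg_order_le k g (V : finType) (e : rel V) :
  kg_graph k g e -> exists2 n, is_kg_order k g n & n <= #|V|.
Proof.
have [m] := ubnP #|V|; elim: m V e => // m IHm V e lt_m He.
have [[W [f [Hf lt_f]]]|noW] := classic
  (exists (W : finType) (f : rel W), kg_graph k g f /\ #|W| < #|V|).
  have [n Hn le_n] := IHm W f (leq_trans lt_f lt_m) Hf.
  by exists n => //; apply: leq_trans le_n (ltnW lt_f).
exists #|V| => //; split; first by exists V, e.
move=> W f Hf; rewrite leqNgt; apply/negP => lt_f.
by apply: noW; exists W, f.
Qed.

Lemma superset_of_card (T : finType) (C : {set T}) k :
  #|C| <= k -> k <= #|T| -> exists2 A : {set T}, C \subset A & #|A| = k.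
Proof.
move=> leCk; rewrite -(subnKC leCk); elim: (k - #|C|) => [|n IHn] le_T.
  by exists C; rewrite ?addn0.
rewrite addnS in le_T *; have [A sCA cardA] := IHn (ltnW le_T).
have /card_gt0P[x] : 0 < #|~: A| by rewrite cardsCs setCK cardA subn_gt0.
rewrite inE => xA; exists (x |: A); last by rewrite cardsU1 xA cardA.
exact: subset_trans sCA (subsetUr _ _).
Qed.

(** The first two entries are swapped and the tail is handled recursively. *)
Lemma even_seq_involution (T : eqType) (s : seq T) :
  uniq s -> ~~ odd (size s) ->
  exists f : T -> T, {in s, forall x, [/\ f x \in s, f x != x & f (f x) = x]}.
Proof.
have [n] := ubnP (size s).
elim: n s => // n IHn [|x [|y s]] //=; first by exists id.
rewrite !inE negb_or negbK => lt_n /and3P[/andP[xy xs] ys us] ev.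
have [f Hf] := IHn s (ltnW lt_n) us ev.
exists (fun z => if z == x then y else if z == y then x else f z) => z.
rewrite !inE; case: (eqVneq z x) => [-> _|zx].
  by rewrite eq_sym (negPf xy) !eqxx orbT.
case: (eqVneq z y) => [-> _|zy]; first by rewrite eqxx.
move=> /= zs; have [fs fz ff] := Hf z zs.
rewrite fs !orbT fz; split=> //.
case: eqP => [fx|_]; first by rewrite -fx fs in xs.
by case: eqP => [fy|//]; rewrite -fy fs in ys.
Qed.

(** The pair [x], [y] is split off and the rest, still of even size, is paired arbitrarily.
    Prescribing one pair later provides the added edge of a 7-cycle. *)
Lemma even_set_involution (T : finType) (A : {set T}) x y :
  x \in A -> y \in A -> x != y -> ~~ odd #|A| ->
  exists2 f : T -> T, f x = y &
    {in A, forall z, [/\ f z \in A, f z != z & f (f z) = z]}.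
Proof.
move=> xA yA xy evA; pose B := A :\ x :\ y.
have inA z : z \in A = [|| z == x, z == y | z \in B].
  rewrite !inE; case: (eqVneq z x) => [->|_] //=.
  by case: (eqVneq z y) => [->|_].
have evB : ~~ odd (size (enum B)).
  move: evA; rewrite (cardsD1 x) xA (cardsD1 y) !inE eq_sym xy yA /= negbK.
  by rewrite cardE.
have [f Hf] := even_seq_involution (enum_uniq B) evB.
exists (fun z => if z == x then y else if z == y then x else f z).
  by rewrite eqxx.
move=> z; rewrite !inA; case: (eqVneq z x) => [-> _|zx].
  by rewrite eq_sym (negPf xy) !eqxx orbT.
case: (eqVneq z y) => [-> _|zy]; first by rewrite eqxx.
rewrite -mem_enum => zB; have [fB fz ff] := Hf z zB.
move: fB; rewrite mem_enum => fB.
rewrite fB !orbT fz; split=> //; move: fB; rewrite !inE.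
by case/and3P=> /negPf-> /negPf->.
Qed.

(** By symmetry, vertices outside [D] are isolated, so [e] and its restriction to [D] have the same
    cycles. Degrees and girth can therefore be computed in the ambient type. *)
Lemma induced_kg_graph (T : finType) (e : rel T) (D : {set T}) k g c :
  simple_graph e -> (forall x y, e x y -> y \in D) ->
  (forall x, x \in D -> #|[set y | e x y]| = k) ->
  (forall c, graph_cycle e c -> g <= size c) ->
  graph_cycle e c -> size c = g ->
  kg_graph k g (fun x y : {x | x \in D} => e (val x) (val y)).
Proof.
move=> [e_sym e_irr] eD deg_k girth_ge [c_gt2 c_cycle] size_c; split.
- by split=> [x y|x]; [apply: e_sym | apply: e_irr].
- move=> x; rewrite -(deg_k _ (valP x)) -(card_imset _ val_inj).
  apply: eq_card => y; rewrite inE; apply/imsetP/idP => [[z]|exy].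
    by rewrite inE => ? ->.
  by exists (Sub y (eD _ _ exy)); rewrite ?inE SubK.
- have val_cycle (s : seq {x | x \in D}) :
    graph_cycle (fun x y : {x | x \in D} => e (val x) (val y)) s
      <-> graph_cycle e (map val s).
    rewrite /graph_cycle /ucycle /ucycleb size_map (map_inj_uniq val_inj).
    by case: s => //= x s; rewrite -map_rcons path_map.
  split=> [|s /val_cycle s_cycle]; last first.
    by rewrite -(size_map val); apply: girth_ge.
  (* Each vertex of the cycle is the end of the edge from its predecessor. *)
  have cD : {in c, forall x, x \in D}.
    by move=> x xc; apply: eD (prev_cycle _ xc); case/andP: c_cycle.
  have cK : map val (pmap (insub : T -> option {x | x \in D}) c) = c.
    rewrite pmap_filter; last exact: insubK.
    by apply/all_filterP/allP=> x /cD xD; rewrite isSome_insub.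
  exists (pmap (insub : T -> option {x | x \in D}) c).
    by apply/val_cycle; rewrite cK.
  by rewrite -(size_map val) cK.
Qed.

(** * Girth of an incidence graph with a matching added on the lines *)

Definition matched_incidence (P L : Type) (inc : P -> L -> bool) (mt : rel L) :
    rel (P + L) :=
  fun u v => match u, v with
    | inl p, inr l | inr l, inl p => inc p l
    | inr l, inr m => mt l m
    | inl _, inl _ => false
    end.

(** Without added edges a cycle has even length, and 4 and 6 are excluded. The ends of an added edge
    are at incidence distance at least 6, so a cycle with one such edge has length at least 7.
    Distinct matched lines are never concurrent, so two successive added edges are at least 4
    incidences apart. *)
Lemma matched_incidence_girth (P L : finType) (inc : P -> L -> bool)
    (mt : rel L) :
  symmetric mt -> irreflexive mt ->
  (forall l m n, mt l m -> mt l n -> m = n) ->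
  (forall p q l m, inc p l -> inc p m -> inc q l -> inc q m ->
     p = q \/ l = m) ->
  (forall p q r l m n, inc p l -> inc q l -> inc q m -> inc r m ->
     inc r n -> inc p n -> p != q -> q != r -> r != p -> l == m) ->
  (forall p l m l' m', mt l l' -> mt m m' -> inc p l -> inc p m -> l = m) ->
  (forall p q l m n, mt l n -> inc p l -> inc p m -> inc q m -> inc q n ->
     False) ->
  forall c, graph_cycle (matched_incidence inc mt) c -> 6 < size c.
Proof.
move=> mt_sym mt_irr mt_fun no4 no6 mt_disj mt_far c [].
have mt_path3 l m n : mt l m -> mt m n -> l != n -> False.
  by rewrite mt_sym => ml mn; rewrite (mt_fun _ _ _ ml mn) eqxx.
have [|] := boolP (has (fun v : P + L => if v is inl _ then true else false) c).
  case/hasP=> [[p|//] pc _].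
  (* Rotated to begin at a point, a cycle of length at most 6 follows one of finitely many patterns
     of points and lines. Patterns with two adjacent points vanish at once. *)
  have /rot_to[i s rot_c] := pc.
  rewrite /ucycle /ucycleb -(size_rot i c) -(rot_cycle i) -(rot_uniq i) rot_c.
  case: s {rot_c} => [|[p1|l1] [|[p2|l2] [|[p3|l3] [|[p4|l4] [|[p5|l5]
    [|v6 s]]]]]] //= _; rewrite ?andbF //=
    !inE ?eqE /= -?eqE ?orbF ?negb_or /= -?andbA ?andbT ?andTb.
  - case/and5P=> pl1 p2l1 p2l3 pl3 /andP[/eqP pp2 /eqP l13].
    by case: (no4 _ _ _ _ pl1 pl3 p2l1 p2l3).
  - case/and5P=> pl1 p2l1 p2l3 p4l3 /and5P[p4l5 pl5 pp2 pp4].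
    case/and4P=> /negP l13 _ p24 _; case: l13.
    by apply: (no6 p p2 p4 l1 l3 l5) => //; rewrite eq_sym.
  - by case/and5P=> pl1 p2l1 p2l3 mt34 /andP[pl4 _]; case: (mt_far p2 p l3 l1 l4).
  - case/and5P=> _ _ _ mt34 /and5P[mt45 _ _ _ /and5P[_ _ _ l35 _]].
    by case: (mt_path3 l3 l4 l5).
  - by case/and4P=> pl1 mt12 pl2 _; case: (mt_far p p l1 l1 l2).
  - by case/and5P=> pl1 mt12 p3l2 p3l4 /andP[pl4 _]; case: (mt_far p p3 l1 l4 l2).
  - case/and5P=> pl1 mt12 _ _ /and5P[mt45 pl5 _ _ /and3P[_ /eqP[]]].
    by rewrite mt_sym in mt45; apply: mt_disj mt12 mt45 pl1 pl5.
  - by case/and5P=> _ mt12 mt23 _ /and3P[_ l13 _]; case: (mt_path3 l1 l2 l3).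
  - case/and5P=> _ mt12 mt23 _ /and5P[_ _ _ _ /andP[l13 _]].
    by case: (mt_path3 l1 l2 l3).
  - case/and5P=> _ mt12 mt23 _ /and4P[_ _ l13 _].
    by case: (mt_path3 l1 l2 l3).
  - case/and5P=> _ mt12 mt23 _ /and5P[_ _ _ l13 _].
    by case: (mt_path3 l1 l2 l3).
(* A cycle without points would contain two consecutive added edges. *)
case: c => [|[p1|l1] [|[p2|l2] [|[p3|l3] s]]] //= _ _.
rewrite /ucycle /ucycleb /= !inE ?eqE /= -?eqE ?negb_or -?andbA.
case/and3P=> mt12 mt23 /and3P[_ _ /andP[l13 _]].
by case: (mt_path3 l1 l2 l3).
Qed.

(** * The matched graph over a finite field *)

Section Construction.
Local Open Scope ring_scope.

(* The affine part of a generalized quadrangle, with first coordinates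
   restricted to A; the points (0, 0, c) are incident with nothing. *)
Definition gq_inc (F : finFieldType) (A : {set F}) (p l : F * F * F) : bool :=
  let: (a, b, c) := p in let: (x, y, z) := l in
  [&& a \in A, x \in A, (a, b) != (0, 0), y == a * x - b & z == a * y - c].

Definition line_matching (F : finFieldType) (A : {set F}) (f : F -> F) :
    rel (F * F * F) :=
  fun l m => [&& l.1.1 \in A, m.1.1 \in A, l.1.2 == 0, m.1.2 == 0,
                 l.2 == m.2 & m.1.1 == f l.1.1].

Definition matched_gq (F : finFieldType) (A : {set F}) (f : F -> F) :
    rel (F * F * F + F * F * F) :=
  matched_incidence (gq_inc A) (line_matching A f).

Definition gq_vertices (F : finFieldType) (A : {set F}) :
    {set F * F * F + F * F * F} :=
  [set v | match v with
           | inl (a, b, c) => (a \in A) && ((a, b) != (0, 0))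
           | inr (x, _, _) => x \in A
           end].

(** Solving for [b] and [c] shows that a point on a given line is determined by [a], and lets later
    proofs substitute. *)
Lemma gq_incP (F : finFieldType) (A : {set F}) a b c x y z :
  reflect [/\ a \in A, x \in A, a = 0 -> b <> 0, b = a * x - y
             & c = a * y - z]
          (gq_inc A (a, b, c) (x, y, z)).
Proof.
apply: (iffP and5P) => [[-> -> ab /eqP-> /eqP->]|[aA xA ab eb ec]].
  split=> //; [|by ring|by ring].
  by move=> a0 b0; rewrite a0 b0 eqxx in ab.
split=> //; [|by rewrite eb subKr|by rewrite ec subKr].
by apply/eqP=> -[a0 b0]; apply: ab.
Qed.

Lemma line_matchingP (F : finFieldType) (A : {set F}) f x y z x' y' z' :
  reflect [/\ x \in A, x' \in A, y = 0, y' = 0 & z = z' /\ x' = f x]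
          (line_matching A f (x, y, z) (x', y', z')).
Proof.
rewrite /line_matching /=.
by apply: (iffP and5P) => [[-> -> /eqP-> /eqP-> /andP[/eqP-> /eqP->]]|
  [-> -> -> -> [-> ->]]]; rewrite ?eqxx.
Qed.

(** Points of one line with equal first coordinates coincide. Otherwise, eliminating [y] and [y']
    gives [(a - a') * (x - x') = 0], and [x = x'] forces the lines to agree. *)
Lemma gq_inc_C4_free (F : finFieldType) (A : {set F}) p q l m :
  gq_inc A p l -> gq_inc A p m -> gq_inc A q l -> gq_inc A q m ->
  p = q \/ l = m.
Proof.
case: p q l m => [[a b] c] [[a' b'] c'] [[x y] z] [[x' y'] z'].
case/gq_incP=> _ _ _ -> -> /gq_incP[_ _ _ eb ec].
case/gq_incP=> _ _ _ -> -> /gq_incP[_ _ _ eb' ec'].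
have [->|aa] := eqVneq a a'; [by left|right].
have ex : x = x'.
  apply/eqP; rewrite -subr_eq0; have /eqP : (a - a') * (x - x') = 0.
    have -> : (a - a') * (x - x')
      = (a * x - y - (a * x' - y')) - (a' * x - y - (a' * x' - y')) by ring.
    by rewrite eb eb' !subrr.
  by rewrite mulf_eq0 !subr_eq0 (negPf aa).
move: eb ec; rewrite -ex => /addrI/oppr_inj <-.
by move=> /addrI/oppr_inj <-.
Qed.

Lemma gq_inc_C6_free (F : finFieldType) (A : {set F}) p q r l m n :
  gq_inc A p l -> gq_inc A q l -> gq_inc A q m -> gq_inc A r m ->
  gq_inc A r n -> gq_inc A p n -> p != q -> q != r -> r != p -> l == m.
Proof.
case: p q r => [[a b] c] [[a' b'] c'] [[a'' b''] c''].
case: l m n => [[x y] z] [[x' y'] z'] [[x'' y''] z''].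
case/gq_incP=> _ _ _ -> -> /gq_incP[_ _ _ -> ->].
case/gq_incP=> _ _ _ eb' ec' /gq_incP[_ _ _ -> ->].
case/gq_incP=> _ _ _ eb'' ec'' /gq_incP[_ _ _ eb ec] pq qr rp.
have qa : a' != a''.
  by apply: contraNneq qr => <-; rewrite eb' ec'.
have pa : a != a'.
  by apply: contraNneq pq => ->.
(* The relations say that x - x'', x' - x, x'' - x' lie in the kernel of the
   Vandermonde matrix of a, a', a''. *)
have ex : x = x'.
  apply/eqP; rewrite -subr_eq0.
  have /eqP : (a - a') * (a' - a'') * (x - x') = 0.
    have -> : (a - a') * (a' - a'') * (x - x')
      = (a * y - z - (a * y'' - z'')) - (a' * y - z - (a' * y' - z'))
        - (a'' * y' - z' - (a'' * y'' - z''))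
        - a'' * (a * x - y - (a * x'' - y''))
        + (a + a'' - a') * (a' * x - y - (a' * x' - y'))
        + a * (a'' * x' - y' - (a'' * x'' - y'')) by ring.
    by rewrite ec ec' ec'' eb eb' eb'' !subrr !mulr0 !subr0 !addr0.
  by rewrite !mulf_eq0 !subr_eq0 (negPf pa) (negPf qa).
move: eb' ec'; rewrite -ex => /addrI/oppr_inj <-.
by move=> /addrI/oppr_inj <-.
Qed.

Lemma line_matching_sym (F : finFieldType) (A : {set F}) f :
  {in A, involutive f} -> symmetric (line_matching A f).
Proof.
move=> fK; suff mtS l m : line_matching A f l m -> line_matching A f m l.
  by move=> l m; apply/idP/idP; apply: mtS.
case: l m => [[x y] z] [[x' y'] z'] /line_matchingP[xA x'A -> -> [-> ex']].
by apply/line_matchingP; split=> //; rewrite ex' fK.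
Qed.

(** A point on [[x, 0, z]] has [b = a * x] and [c = - z]. Here [a = 0] would give a removed point,
    so [a] cancels and the point determines the line. *)
Lemma gq_line_matching_disjoint (F : finFieldType) (A : {set F}) f p l m l' m' :
  line_matching A f l l' -> line_matching A f m m' ->
  gq_inc A p l -> gq_inc A p m -> l = m.
Proof.
case: p l m l' m' => [[a b] c] [[x y] z] [[x' y'] z'] [[? ?] ?] [[? ?] ?].
case/line_matchingP=> _ _ -> _ _ /line_matchingP[_ _ -> _ _].
case/gq_incP=> _ _ ab eb -> /gq_incP[_ _ _ eb' /addrI/oppr_inj->].
have a0 : a != 0.
  by apply/eqP=> a0; apply: (ab a0); rewrite eb a0 mul0r subr0.
by move: eb'; rewrite eb !subr0 => /(mulfI a0)->.
Qed.

(** Both points have third coordinate [- z], so [a * y' = a' * y']. If [y' = 0], then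
    [x = x' = f x]; otherwise [a = a'], and comparing second coordinates again gives [x = f x]. *)
Lemma gq_line_matching_far (F : finFieldType) (A : {set F}) f p q l m n :
  {in A, forall x, f x != x} -> line_matching A f l n ->
  gq_inc A p l -> gq_inc A p m -> gq_inc A q m -> gq_inc A q n -> False.
Proof.
move=> f_neq; case: p q => [[a b] c] [[a' b'] c'].
case: l m n => [[x y] z] [[x' y'] z'] [[x'' y''] z''].
case/line_matchingP=> xA _ -> -> [<- ->].
case/gq_incP=> _ _ ab eb0 -> /gq_incP[_ _ _ eb ec].
case/gq_incP=> _ _ ab' eb0' -> /gq_incP[_ _ _ eb' ec'].
move: ab ab' eb eb' ec ec'; rewrite {b}eb0 {b'}eb0'.
rewrite !mulr0 !subr0 => ab ab' eb eb' ec ec'; case/eqP: (f_neq x xA).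
have a0 : a != 0.
  by apply/eqP=> a0; apply: (ab a0); rewrite a0 mul0r.
have [y0|y0] := eqVneq y' 0.
  have a'0 : a' != 0.
    by apply/eqP=> a'0; apply: (ab' a'0); rewrite y0 a'0 mul0r subr0.
  move: eb eb'; rewrite y0 !subr0 => /(mulfI a0)->.
  by move/(mulfI a'0)/esym.
have aa : a = a'.
  by apply: (mulIf y0); apply: (addIr (- z')); rewrite -ec ec'.
by apply: (mulfI a0); rewrite eb aa eb'.
Qed.

(** Neighbours are indexed injectively by [A]: those of a point by the [x] of the line, those of a
    line by the [a] of the point. *)
Lemma matched_gq_degree (F : finFieldType) (A : {set F}) f v :
  0 \in A -> {in A, forall x, f x \in A} -> v \in gq_vertices A ->
  #|[set u | matched_gq A f v u]| = #|A|.
Proof.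
move=> A0 fA; case: v => [[[a b] c]|[[x y] z]]; rewrite inE.
  case/andP=> aA ab.
  pose h x : F * F * F + F * F * F := inr (x, a * x - b, a * (a * x - b) - c).
  have h_inj : injective h by move=> x x' [].
  rewrite -(card_imset (mem A) h_inj).
  apply: eq_card => -[[[x y] z]|[[x y] z]]; rewrite inE; apply/idP/imsetP.
  - by [].
  - by case.
  - by case/and5P=> _ xA _ /eqP-> /eqP->; exists x.
  - by case=> x' xA [-> -> ->]; rewrite /= aA xA ab !eqxx.
move=> xA.
(* The matching partner takes the place of the removed point (0, 0, - z). *)
pose g a : F * F * F + F * F * F :=
  if (a == 0) && (y == 0) then inr (f x, y, z)
  else inl (a, a * x - y, a * y - z).
have g_inj : injective g.
  move=> a a'; rewrite /g.
  case: ifP => [/andP[/eqP-> _]|_]; case: ifP => [/andP[/eqP-> _]|_] //.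
  by case.
rewrite -(card_imset (mem A) g_inj).
apply: eq_card => u; rewrite inE; apply/idP/imsetP.
  case: u => [[[a b] c]|[[x' y'] z']].
    case/gq_incP=> aA _ ab eb ->; exists a => //.
    rewrite /g eb; case: andP => // -[/eqP a0 /eqP y0].
    by case: (ab a0); rewrite eb a0 y0 mul0r subr0.
  case/line_matchingP=> _ _ y0 -> [<- ->].
  by exists 0; rewrite // /g y0 !eqxx.
case=> a aA ->; rewrite /g; case: ifP => [/andP[_ /eqP->]|/andP ay].
  by apply/line_matchingP; split; rewrite ?fA.
apply/gq_incP; split=> // a0 /eqP.
by rewrite a0 mul0r sub0r oppr_eq0 => y0; apply: ay; rewrite a0.
Qed.

Lemma card_gq_vertices (F : finFieldType) (A : {set F}) :
  0 \in A -> #|gq_vertices A| = (2 * #|A| * #|F| ^ 2 - #|F|)%N.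
Proof.
move=> A0; pose L := setX (setX A [set: F]) [set: F].
(* The removed points, which lie in [L] because [0 \in A]. *)
pose X := setX (setX [set 0 : F] [set 0 : F]) [set: F].
have -> : gq_vertices A = (inl @: (L :\: X)) :|: (inr @: L).
  apply/setP=> -[[[a b] c]|[[x y] z]]; rewrite !inE.
    rewrite (mem_imset _ _ inl_inj) !inE.
    by rewrite xpair_eqE !andbT andbC orbC; case: imsetP => // -[].
  by rewrite (mem_imset _ _ inr_inj) !inE !andbT; case: imsetP => // -[].
rewrite cardsU disjoint_setI0 ?cards0 ?subn0; last first.
  by apply/pred0P=> u /=; apply/andP=> -[/imsetP[? _ ->] /imsetP[? _]].
rewrite !card_imset; [|exact: inr_inj|exact: inl_inj].
rewrite cardsD (setIidPr _) ?cardsX ?cards1 ?cardsT; last first.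
  by apply/subsetP=> -[[a b] c]; rewrite !inE => /andP[/andP[/eqP-> _] _]; rewrite A0.
have : (0 < #|A|)%N by apply/card_gt0P; exists 0.
rewrite !mul1n; move: #|A| #|F| => m n m_gt0.
have -> : (2 * m * n ^ 2 = m * n * n + m * n * n)%N by rewrite expnS expn1; lia.
(* This keeps the truncated subtraction exact, so it commutes with adding the lines. *)
have : (n <= m * n * n)%N by nia.
by lia.
Qed.

Lemma matched_gq_kg_graph (F : finFieldType) (A : {set F}) f :
  [/\ 0 \in A, 1 \in A & 2 \in A] -> f 0 = 1 ->
  {in A, forall z, [/\ f z \in A, f z != z & f (f z) = z]} ->
  kg_graph #|A| 7 (fun u v : {v | v \in gq_vertices A} =>
                     matched_gq A f (val u) (val v)).
Proof.
move=> [A0 A1 A2] f0 fP.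
have fK : {in A, involutive f} by move=> z /fP[].
have mt_sym := line_matching_sym fK.
have mt_irr : irreflexive (line_matching A f).
  move=> [[x y] z]; apply/line_matchingP => -[/fP[_ /eqP fx _] _ _ _ [_ ex]].
  by rewrite -ex in fx.
(* Six incidences, closed by the added edge from [[1, 0, 0]] to [[0, 0, 0]]. *)
pose C : seq (F * F * F + F * F * F) :=
  [:: inr (0, 0, 0); inl (1, 0, 0); inr (1, 1, 1); inl (0, -1, -1);
      inr (2, 1, 1); inl (1, 1, 0); inr (1, 0, 0)].
apply: (@induced_kg_graph _ (matched_gq A f) _ _ _ C) => //.
- split=> [[p|l] [q|m]|[p|l]] //=.
- move=> [[[a b] c]|[[x y] z]] [[[a' b'] c']|[[x' y'] z']]; rewrite inE //.
  + by case/and5P.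
  + by case/and5P=> -> _ ->.
  + by case/line_matchingP.
- by move=> v; apply: matched_gq_degree => // z /fP[].
- apply: matched_incidence_girth => //.
  + move=> [[x y] z] [[x' y'] z'] [[x'' y''] z''].
    case/line_matchingP=> _ _ _ -> [<- ->].
    by case/line_matchingP=> _ _ _ -> [<- ->].
  + exact: gq_inc_C4_free.
  + exact: gq_inc_C6_free.
  + exact: gq_line_matching_disjoint.
  + by move=> p q l m n; apply: gq_line_matching_far => z /fP[].
(* This separates [[1, 1, 1]] from [[2, 1, 1]] in every characteristic; if [2 = 0], the lines
   [[0, 0, 0]] and [[2, 1, 1]] still differ in [y]. *)
have n21 : (2 == 1 :> F) = false.
  by rewrite -subr_eq0 -[2]/(1 + 1) addrK oner_eq0.
split=> //; rewrite /ucycle /ucycleb; apply/andP; split.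
  have f1 : f 1 = 0 by rewrite -f0 fK.
  rewrite /= A0 A1 A2 /line_matching /= f1 A0 A1 !xpair_eqE !oner_eq0 oppr_eq0 oner_eq0 !eqxx /=.
  rewrite !mul0r !mul1r !subr0 !sub0r !subrr !opprK ?eqxx ?andbT /=.
  by rewrite eq_sym -[2]/(1 + 1) addrK.
rewrite /= !inE ?eqE /= -?eqE !xpair_eqE !oner_eq0.
by rewrite (eq_sym (0 : F) 1) (eq_sym (1 : F) 2) n21 oner_eq0 !andbF.
Qed.

End Construction.

(** * The bounds on the order *)

Lemma exists_kg_graph7 (F : finFieldType) k :
  2 < k -> ~~ odd k -> k <= #|F| ->
  exists (V : finType) (e : rel V),
    kg_graph k 7 e /\ #|V| = 2 * k * #|F| ^ 2 - #|F|.
Proof.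
move=> k_gt2 ev_k le_k.
have [A sCA cardA] : exists2 A : {set F}, [set 0; 1; 2]%R \subset A & #|A| = k.
  (* The set has at most three elements, and only two in characteristic 2. *)
  apply: superset_of_card le_k; apply: leq_trans k_gt2.
  by rewrite -!setUA !cardsU1 cards1; do 2?case: (_ \notin _).
have [A0 A1 A2] : [/\ 0 \in A, 1 \in A & 2 \in A]%R.
  by split; apply: (subsetP sCA); rewrite !inE eqxx ?orbT.
have [||f f0 fP] := even_set_involution A0 A1; rewrite ?cardA //.
  by rewrite eq_sym oner_neq0.
exists {v | v \in gq_vertices A}, (fun u v => matched_gq A f (val u) (val v)).
rewrite card_sig -cardA -(card_gq_vertices A0); split=> //.
exact: matched_gq_kg_graph.
Qed.

Lemma kg_order7_le k q :
  prime_power q -> 2 < k -> ~~ odd k -> k <= q ->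
  exists2 n, is_kg_order k 7 n & n <= 2 * k * q ^ 2 - q.
Proof.
case=> p [m [p_pr m_gt0 ->]] k_gt2 ev_k.
have [F _ <-] := PrimePowerField p_pr m_gt0 => le_k.
have [V [e [He <-]]] := exists_kg_graph7 k_gt2 ev_k le_k.
exact: kg_order_le He.
Qed.

Theorem theorem10 :
  (forall k q : nat,
     4 <= k -> ~~ odd k -> smallest_prime_power_geq k q ->
     exists2 n : nat, is_kg_order k 7 n & n <= 2 * k * q ^ 2 - q) /\
  (forall q : nat,
     prime_power q -> odd q -> 4 <= q - 1 ->
     (exists2 n : nat, is_kg_order (q - 1) 7 n
        & n <= 2 * q ^ 3 - 2 * q ^ 2 - q) /\
     2 * q ^ 3 - 2 * q ^ 2 - q
       = 2 * (q - 1) ^ 3 + 4 * (q - 1) ^ 2 + (q - 1) - 1).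
Proof.
split=> [k q k_ge4 ev_k [q_pp le_kq _]|q q_pp odd_q q_ge5].
  by apply: kg_order7_le => //; apply: ltnW.
split; last by nia.
(* This is the general bound for [k = q - 1], which is even as [q] is odd, over the field with [q]
   elements. *)
have -> : 2 * q ^ 3 - 2 * q ^ 2 - q = 2 * (q - 1) * q ^ 2 - q.
  by rewrite -mulnBr; congr (_ - _); nia.
apply: kg_order7_le => //; [exact: ltnW|by rewrite oddB ?odd_q //; lia|].
exact: leq_subr.
Qed.
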